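(* Let $n,k$ be positive integers with $1\le k\le n-2$, and let $G$ be a strongly connected simple digraph on $n$ vertices with vertex connectivity $k$. Then: (i) for $\alpha=0$, $\lambda_\alpha(G)\le\frac{n-2+\sqrt{n^2-4n+4k+4}}{2}$, with equality if and only if $G\cong K(n,k,n-k-1)$ or $G\cong K(n,k,1)$; (ii) for $0<\alpha<1$, $$\lambda_\alpha(G)\le\frac{n-2+\alpha+\alpha k+\sqrt{n^2+(2\alpha-4-2\alpha k)n+\alpha^2+\alpha^2k^2-4\alpha+2\alpha^2k-4\alpha k+4k+4}}{2},$$ with equality if and only if $G\cong K(n,k,n-k-1)$.
   Context: For a simple digraph $G$, $A(G)$ is the adjacency matrix, $D(G)$ the diagonal matrix of outdegrees, $A_\alpha(G)=\alpha D(G)+(1-\alpha)A(G)$ for $\alpha\in[0,1)$, and $\lambda_\alpha(G)$ is the largest modulus of the eigenvalues of $A_\alpha(G)$. Strongly connected: for every ordered pair of vertices there is a directed path from the first to the second. The vertex connectivity of a strongly connected digraph is the minimum number of vertices whose deletion yields a digraph that is not strongly connected. $K(n,k,m)$ ($1\le m\le n-k-1$) is the digraph whose vertex set is partitioned into sets $S$, $V_1$, $V_2$ with $|S|=k$, $|V_1|=m$, $|V_2|=n-k-m$, and whose arcs are all ordered pairs $(u,v)$ of distinct vertices except those with $u\in V_2$ and $v\in V_1$. *)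

(* Defs.v *)
From HB Require Import structures.
From mathcomp Require Import all_boot all_order all_algebra.
From mathcomp Require Import reals.
From mathcomp.real_closed Require Import complex.

Set Implicit Arguments.
Unset Strict Implicit.
Unset Printing Implicit Defensive.

Import Order.TTheory GRing.Theory Num.Theory.
Local Open Scope ring_scope.

(* A simple digraph is an irreflexive [e : rel T] on a finite vertex type,    *)
(* with [e u v] meaning that (u, v) is an arc.                                *)

Definition strongly_connected (T : finType) (e : rel T) : Prop :=
  forall u v : T, connect e u v.

Definition delete_vertices (T : finType) (e : rel T) (S : {set T}) :
    rel {x : T | x \notin S} :=
  fun u v => e (val u) (val v).
Arguments delete_vertices {T} e S u v.

(* A digraph with at most one vertex is strongly connected, so a set whose    *)
(* deletion disconnects leaves at least two vertices; a complete digraph has  *)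
(* no such set, and this relation then holds for no k.                        *)
Definition has_vertex_connectivity (T : finType) (e : rel T) (k : nat) : Prop :=
  (exists2 S : {set T}, #|S| = k & ~ strongly_connected (delete_vertices e S))
  /\ (forall S : {set T},
        ~ strongly_connected (delete_vertices e S) -> (k <= #|S|)%N).

Definition digraph_iso (T1 T2 : finType) (e1 : rel T1) (e2 : rel T2) : Prop :=
  exists2 f : T1 -> T2, bijective f & forall u v, e2 (f u) (f v) = e1 u v.

(* K(n,k,m) with S = [0, k), V_1 = [k, k + m), V_2 = [k + m, n).              *)
Definition K_digraph (n k m : nat) : rel 'I_n :=
  fun u v => (u != v) && ~~ ((k + m <= u)%N && (k <= v < k + m)%N).
Arguments K_digraph n k m u v : clear implicits.

Section Spectral.
Variables (R : realType) (n : nat).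

Definition outdegree (e : rel 'I_n) (u : 'I_n) : nat := #|[set v | e u v]|.

Definition adjacency_mx (e : rel 'I_n) : 'M[R]_n :=
  \matrix_(u, v) (e u v)%:R.

Definition outdegree_mx (e : rel 'I_n) : 'M[R]_n :=
  diag_mx (\row_u (outdegree e u)%:R).

Definition A_alpha (alpha : R) (e : rel 'I_n) : 'M[R]_n :=
  alpha *: outdegree_mx e + (1 - alpha) *: adjacency_mx e.

Definition complex_mx (A : 'M[R]_n) : 'M[R[i]]_n := map_mx (real_complex R) A.

(* The complex eigenvalues, listed with algebraic multiplicity.               *)
Definition eigenvalues (A : 'M[R]_n) : seq R[i] :=
  sval (closed_field_poly_normal (char_poly (complex_mx A))).

Lemma mem_eigenvalues (A : 'M[R]_n) (z : R[i]) :
  (z \in eigenvalues A) = eigenvalue (complex_mx A) z.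
Proof.
rewrite /eigenvalues; case: closed_field_poly_normal => /= s Es.
rewrite eigenvalue_root_char Es (monicP (char_poly_monic _)) scale1r.
by rewrite root_prod_XsubC.
Qed.

(* The default 0 matters only for n = 0.                                      *)
Definition spectral_radius (A : 'M[R]_n) : R :=
  \big[Num.max/0]_(z <- eigenvalues A) ComplexField.Normc.normc z.

Definition lambda_alpha (alpha : R) (e : rel 'I_n) : R :=
  spectral_radius (A_alpha alpha e).

End Spectral.

(* Main.v *)
Require Import Defs.
From HB Require Import structures.
From mathcomp Require Import all_boot all_order all_algebra.
From mathcomp Require Import reals ring lra zify.
From mathcomp.real_closed Require Import complex.

Set Implicit Arguments.
Unset Strict Implicit.
Unset Printing Implicit Defensive.

Import Order.TTheory GRing.Theory Num.Theory.
Local Open Scope ring_scope.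

(* Deleting a minimum separator leaves a part V2 with no arc to the rest V1,  *)
(* so G is a spanning subdigraph of a digraph K isomorphic to K(n,k,|V1|).    *)
(* Let L be the bound.  There is a positive vector y, constant on V2 and on   *)
(* its complement, such that A(K) y <= L y with equality on V2; off V2 the    *)
(* defect is                                                                  *)
(*    (|V2| - 1) (alpha (n - 1 - L) + (1 - alpha) (|V1| - 1)),                *)
(* which is nonnegative because L < n - 1, and vanishes exactly when |V2| = 1,*)
(* or alpha = 0 and |V1| = 1.  Pairing y with the moduli of a left eigenvector*)
(* of A(G) gives lambda <= L; if lambda = L, strong connectivity makes these  *)
(* moduli positive, so that A(G) y = L y, whence G = K and the defect is 0.   *)
(* Conversely, if the defect is 0, then y is an eigenvector of A(K) for L.    *)

(** In K every vertex outside V2 has all other vertices as out-neighbours, so the partition into V2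
    and its complement is equitable for [A_alpha], and K reduces to a 2 x 2 quotient
    ([one_way_cut_mul]). For |V2| = 1 the largest eigenvalue of this quotient is [alpha_bound],
    located by [alpha_boundP]. A Collatz-Wielandt comparison with a single test vector handles all
    sizes of V2 at once: [spectral_radius_le] gives the bound and [spectral_radius_eq] the rigidity.
    [separator_one_way_cut] produces K from G, and [digraph_iso_K_digraph] turns equality with K
    into an isomorphism. *)

Lemma sumr_le_eqP (R : numDomainType) (I : finType) (F F' : I -> R) :
  (forall i, F i <= F' i) -> \sum_i F i = \sum_i F' i -> forall i, F i = F' i.
Proof.
move=> leF sumF i; apply/eqP; rewrite eq_sym -subr_eq0; apply/eqP.
apply: (psumr_eq0P (P := xpredT) (F := fun i => F' i - F i)) => //.
- by move=> j _; rewrite subr_ge0.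
- by rewrite sumrB sumF subrr.
Qed.

(** * Collatz-Wielandt bounds for the spectral radius of a nonnegative matrix *)

Section SpectralRadius.
Variables (R : realType) (n : nat) (A : 'M[R]_n).

Lemma spectral_radius_attained :
  spectral_radius A = 0 \/
  exists2 z, z \in eigenvalues A & spectral_radius A = ComplexField.Normc.normc z.
Proof.
rewrite /spectral_radius; elim: (eigenvalues A) => [|z s IHs].
  by left; rewrite big_nil.
rewrite big_cons; case: leP => _; last by right; exists z; rewrite ?mem_head.
case: IHs => [->|[t st ->]]; first by left.
by right; exists t; rewrite // inE st orbT.
Qed.

Lemma normc_le_spectral_radius z :
  z \in eigenvalues A -> ComplexField.Normc.normc z <= spectral_radius A.
Proof.
by move=> Az; exact: (@Order.TotalTheory.le_bigmax_seq _ _ _ _ 0 z xpredT).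
Qed.

Lemma right_eigenvector_spectral_radius (y : 'I_n -> R) (b : R) i0 :
  0 <= b -> y i0 != 0 -> (forall i, \sum_j A i j * y j = b * y i) ->
  b <= spectral_radius A.
Proof.
move=> b_ge0 y_neq0 Ay.
suff /normc_le_spectral_radius : b%:C%C \in eigenvalues A.
  by rewrite /= expr0n addr0 sqrtr_sqr ger0_norm.
(* [eigenvalue] refers to row vectors while [y] is a column, so the passage goes through the
   singularity of A - b. *)
rewrite mem_eigenvalues /eigenvalue /eigenspace kermx_eq0 row_free_unit.
apply/negP => Au; pose Y : 'cV[R[i]]_n := \col_i (y i)%:C%C.
have AY : (complex_mx A - (b%:C%C)%:M) *m Y = 0.
  apply/colP => i; rewrite mulmxBl mul_scalar_mx !mxE.
  under eq_bigr do rewrite !mxE -rmorphM.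
  by rewrite -rmorph_sum Ay rmorphM subrr.
have Y0 : Y = 0 by rewrite -[Y](mulKmx Au) AY mulmx0.
by case/eqP: y_neq0; move/colP/(_ i0): Y0; rewrite !mxE => -[].
Qed.

Hypothesis A_ge0 : forall i j, 0 <= A i j.

(** Take the moduli of a left eigenvector; the triangle inequality turns the eigenvalue equation
    into an inequality. *)
Lemma eigenvalue_subvector z : z \in eigenvalues A ->
  exists w : 'I_n -> R, [/\ forall i, 0 <= w i, exists i, 0 < w i &
    forall j, ComplexField.Normc.normc z * w j <= \sum_i w i * A i j].
Proof.
rewrite mem_eigenvalues => /eigenvalueP[v vA v_neq0].
have normE (x : R[i]) : `|x| = (ComplexField.Normc.normc x)%:C%C by [].
have norm_ge0 (x : R[i]) : 0 <= ComplexField.Normc.normc x.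
  by rewrite -lecR -normE; exact: normr_ge0.
exists (fun i => ComplexField.Normc.normc (v 0 i)); split => [i||j].
- exact: norm_ge0.
- have [i vi] : exists i, v 0 i != 0 by apply/rV0Pn.
  exists i; rewrite lt_neqAle norm_ge0 andbT eq_sym.
  by apply: contra_neq vi => /ComplexField.Normc.eq0_normc.
- move/rowP/(_ j): vA; rewrite !mxE => /(congr1 (fun x => `|x|)).
  rewrite normrM => vAj.
  rewrite -lecR rmorphM /= -!normE -vAj rmorph_sum.
  apply: le_trans (ler_norm_sum _ _ _) _; apply: ler_sum => i _.
  rewrite normrM mxE rmorphM /= -normE ler_wpM2l //.
  by rewrite normc_def /= expr0n addr0 sqrtr_sqr ger0_norm.
Qed.

Variables (y : 'I_n -> R) (b : R).
Hypotheses (y_gt0 : forall i, 0 < y i)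
  (Ay_le : forall i, \sum_j A i j * y j <= b * y i).

Lemma pairing_exchange (w : 'I_n -> R) :
  \sum_j (\sum_i w i * A i j) * y j = \sum_i w i * \sum_j A i j * y j.
Proof.
under eq_bigr do rewrite mulr_suml.
rewrite exchange_big; apply: eq_bigr => i _ /=.
by rewrite mulr_sumr; apply: eq_bigr => j _; rewrite mulrA.
Qed.

(** For z an eigenvalue of largest modulus and w from [eigenvalue_subvector], |z| (w.y) <= wAy <= b
    (w.y), and w.y > 0 cancels. *)
Lemma spectral_radius_le : 0 <= b -> spectral_radius A <= b.
Proof.
move=> b_ge0; case: spectral_radius_attained => [->//|[z /eigenvalue_subvector]].
move=> [w [w_ge0 [i0 w_i0] wA]] ->; set c := ComplexField.Normc.normc z in wA *.
have wy_gt0 : 0 < \sum_i w i * y i.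
  rewrite (bigD1 i0) //= ltr_wpDr ?mulr_gt0 // sumr_ge0 // => i _.
  by rewrite mulr_ge0 // ltW.
rewrite -(ler_pM2r wy_gt0) !mulr_sumr.
apply: (@le_trans _ _ (\sum_j (\sum_i w i * A i j) * y j)).
  by apply: ler_sum => i _; rewrite mulrA ler_pM2r.
rewrite pairing_exchange; apply: ler_sum => i _.
by rewrite mulrCA ler_wpM2l.
Qed.

(** When |z| = b, the chain b (w.y) <= wAy <= b (w.y) collapses term by term, so wA = b w, and
    (Ay)_i = b y_i wherever w_i > 0. *)
Lemma spectral_radius_eq (e : rel 'I_n) :
  strongly_connected e -> (forall i j, e i j -> 0 < A i j) -> 0 < b ->
  spectral_radius A = b -> forall i, \sum_j A i j * y j = b * y i.
Proof.
move=> e_sc eA b_gt0 rhob.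
case: spectral_radius_attained => [rho0|[z /eigenvalue_subvector]].
  by rewrite -rhob rho0 ltxx in b_gt0.
move=> [w [w_ge0 [i0 w_i0] wA]]; rewrite rhob => zb; rewrite -zb in wA.
have le1 j : b * w j * y j <= (\sum_i w i * A i j) * y j by rewrite ler_pM2r.
have le2 i : w i * (\sum_j A i j * y j) <= b * w i * y i.
  by rewrite -mulrA mulrCA ler_wpM2l.
have sum_eq : \sum_j b * w j * y j = \sum_i w i * \sum_j A i j * y j.
  apply/le_anti; rewrite -{1}pairing_exchange.
  by rewrite !ler_sum.
have eq1 j : b * w j = \sum_i w i * A i j.
  apply: (mulIf (lt0r_neq0 (y_gt0 j))); move: j.
  by apply: sumr_le_eqP; rewrite // sum_eq pairing_exchange.
have eq2 i : w i * (\sum_j A i j * y j) = b * w i * y i.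
  by move: i; apply: sumr_le_eqP; rewrite // sum_eq.
(* Since wA = b w, positivity of w at the tail of an arc passes to its head; it spreads from [i0]
   along directed paths. *)
have w_gt0 i : 0 < w i.
  have : connect e i0 i by [].
  case/connectP => p + ->; elim: p i0 w_i0 => //= j p IHp u w_u.
  case/andP => uj; apply: IHp; rewrite -(pmulr_rgt0 _ b_gt0) eq1 (bigD1 u) //=.
  rewrite ltr_wpDr ?mulr_gt0 ?eA // sumr_ge0 // => l _.
  by rewrite mulr_ge0.
move=> i; apply: (mulfI (lt0r_neq0 (w_gt0 i))).
by rewrite eq2 mulrCA mulrA.
Qed.

End SpectralRadius.

(** * One-way cuts and their identification with K(n,k,m) *)

Section OneWayCut.
Variable T : finType.
Implicit Types e : rel T.

Definition one_way_cut (V1 V2 : {set T}) : rel T :=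
  fun u v => (u != v) && ~~ ((u \in V2) && (v \in V1)).

Lemma separator_one_way_cut e (S : {set T}) :
  irreflexive e -> ~ strongly_connected (delete_vertices e S) ->
  exists V1 V2 : {set T}, [/\ [disjoint V1 & V2], (0 < #|V1|)%N, (0 < #|V2|)%N,
    (#|S| + #|V1| + #|V2| = #|T|)%N & forall u v, e u v -> one_way_cut V1 V2 u v].
Proof.
move=> e_irr nsc; pose e' := delete_vertices e S.
have [u [v uv]] : exists u v, ~~ connect e' u v.
  have : ~~ [forall u, forall v, connect e' u v].
    by apply/negP => /forallP sc; apply: nsc => u v; exact/(forallP (sc u)).
  by case/forallPn => u /forallPn[v]; exists u, v.
(* V2 is what [u] reaches once S is deleted. No arc leaves V2 for a vertex outside S and V2, and [v]
   is such a vertex. *)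
pose V2 := val @: [set x | connect e' u x]; pose V1 := ~: (S :|: V2).
have SV2 : [disjoint S & V2].
  rewrite disjoint_sym disjoints_subset; apply/subsetP => _ /imsetP[x _ ->].
  by rewrite inE (valP x).
exists V1, V2; split.
- by rewrite disjoints_subset subsetC setCK subsetU // subxx orbT.
- apply/card_gt0P; exists (val v); rewrite !inE negb_or (valP v).
  by rewrite mem_imset ?inE //; exact: val_inj.
- by apply/card_gt0P; exists (val u); rewrite imset_f // inE.
- rewrite -(cardsC (S :|: V2)) cardsU (disjoint_setI0 SV2) cards0 subn0.
  by rewrite -/V1 addnAC.
- move=> x y xy; apply/andP; split.
    by apply: contraTneq xy => ->; rewrite e_irr.
  apply/negP => /andP[/imsetP[x' + xE]]; rewrite !inE negb_or => ux' /andP[yS].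
  case/negP; apply/imsetP; exists (Sub y yS); rewrite ?SubK // inE.
  by apply: connect_trans ux' (connect1 _); rewrite /e' /delete_vertices SubK -xE.
Qed.

End OneWayCut.

Lemma digraph_iso_K_digraph (n k m : nat) (e : rel 'I_n) : (k + m <= n)%N ->
  digraph_iso e (K_digraph n k m) <->
  exists V1 V2 : {set 'I_n}, [/\ [disjoint V1 & V2], #|V1| = m,
    #|V2| = (n - k - m)%N & e =2 one_way_cut V1 V2].
Proof.
move=> km_le; split=> [[f f_bij eK]|[V1 [V2 [V12 V1m V2m eE]]]].
- have f_inj := bij_inj f_bij.
  (* Counting through the bijection becomes a sum over naturals, which can be split at the interval
     ends. *)
  have card_pre (P : pred nat) :
      #|[set u | P (f u)]| = (\sum_(0 <= i < n | P i) 1)%N.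
    rewrite big_mkord sum1dep_card -(card_imset _ f_inj); congr #|pred_of_set _|.
    case: f_bij => g _ fK; apply/setP => u; rewrite inE.
    apply/imsetP/idP => [[v + ->]|Pu]; first by rewrite inE.
    by exists (g u); rewrite ?inE fK.
  exists [set u | k <= f u < k + m]%N, [set u | k + m <= f u]%N; split.
  + by rewrite disjoints_subset; apply/subsetP => u; rewrite !inE; lia.
  + rewrite (card_pre (fun i => (k <= i < k + m)%N)).
    rewrite (@big_cat_nat _ _ _ (k + m)) //= (@big_cat_nat _ _ _ k) //= ?leq_addr //.
    rewrite big_nat_cond big_pred0 ?add0n; last by move=> i; lia.
    rewrite [X in (_ + X)%N]big_nat_cond [X in (_ + X)%N]big_pred0 ?addn0; last by move=> i; lia.
    rewrite big_nat_cond (eq_bigl (fun i => (k <= i < k + m) && true)%N); last by move=> i; lia.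
    by rewrite -big_nat_cond sum_nat_const_nat muln1 addKn.
  + rewrite (card_pre (fun i => (k + m <= i)%N)).
    rewrite (@big_cat_nat _ _ _ (k + m)) //=.
    rewrite big_nat_cond big_pred0 ?add0n; last by move=> i; lia.
    rewrite big_nat_cond (eq_bigl (fun i => (k + m <= i < n) && true)%N); last by move=> i; lia.
    by rewrite -big_nat_cond sum_nat_const_nat muln1 subnDA.
  + by move=> u v; rewrite -eK /K_digraph /one_way_cut !inE (inj_eq f_inj).
- pose S := ~: (V1 :|: V2).
  have card_S : #|S| = k.
    have := cardsC (V1 :|: V2); rewrite cardsU (disjoint_setI0 V12) cards0 card_ord.
    by rewrite -/S; lia.
  (* Listing S, V1, V2 in this order makes the position of a vertex in [s] its label in
     [K_digraph]. *)
  pose s := enum S ++ enum V1 ++ enum V2.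
  have mem_s u : u \in s by rewrite !mem_cat !mem_enum !inE; do 2!case: (u \in _).
  have size_s : size s = n by rewrite !size_cat -!cardE; lia.
  have f_lt u : (index u s < n)%N by rewrite -[X in (_ < X)%N]size_s index_mem.
  pose f u := Ordinal (f_lt u).
  have f_inj : injective f.
    by move=> u v /(congr1 val) /= uv; rewrite -(nth_index u (mem_s u)) uv nth_index.
  exists f; first exact: injF_bij.
  have fE u : index u s = if u \in S then index u (enum S) else
      if u \in V1 then (k + index u (enum V1))%N
      else (k + m + index u (enum V2))%N.
    by rewrite !index_cat !mem_enum -!cardE card_S V1m; do 2!case: ifP => //; rewrite ?addnA.
  have ltS u : u \in S -> (index u (enum S) < k)%N.
    by move=> uS; rewrite -card_S cardE index_mem mem_enum.
  have ltV1 u : u \in V1 -> (index u (enum V1) < m)%N.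
    by move=> uV1; rewrite -V1m cardE index_mem mem_enum.
  have V2E u : (k + m <= f u)%N = (u \in V2).
    rewrite /= fE; case: ifPn => [uS|].
      by have := ltS _ uS; move: uS; rewrite !inE negb_or; case: (u \in V2); lia.
    rewrite !inE negbK; case: ifP => [uV1 _|_ /= ->]; last by rewrite leq_addr.
    by rewrite (disjointFr V12 uV1); have := ltV1 _ uV1; lia.
  have V1E u : (k <= f u < k + m)%N = (u \in V1).
    rewrite /= fE; case: ifPn => [uS|_].
      by have := ltS _ uS; move: uS; rewrite !inE negb_or; case: (u \in V1); lia.
    by case: ifP => [uV1|_]; first (have := ltV1 _ uV1); lia.
  by move=> u v; rewrite /K_digraph V2E V1E (inj_eq f_inj) eE.
Qed.

(** * Action of [A_alpha] on vectors that are constant on the parts of a cut *)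

Section AlphaMatrix.
Variables (R : realType) (n : nat) (alpha : R).
Implicit Types (e : rel 'I_n) (y : 'I_n -> R).

Lemma A_alphaE e u v :
  A_alpha alpha e u v =
  alpha * ((outdegree e u)%:R *+ (u == v)) + (1 - alpha) * (e u v)%:R.
Proof. by rewrite !mxE. Qed.

Lemma A_alpha_mul e y u :
  \sum_v A_alpha alpha e u v * y v =
  \sum_(v | e u v) (alpha * y u + (1 - alpha) * y v).
Proof.
under eq_bigr do rewrite A_alphaE mulrDl.
rewrite !big_split /=; congr (_ + _).
  rewrite (bigD1 u) //= eqxx big1 => [|v]; last first.
    by rewrite eq_sym => /negPf->; rewrite mulr0 mul0r.
  rewrite addr0 mulr1n /outdegree cardsE -sum1_card natr_sum mulr_sumr mulr_suml.
  by apply: eq_bigr => v _; rewrite mulr1.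
rewrite [RHS]big_mkcond; apply: eq_bigr => v _.
by case: (e u v); rewrite ?mulr1 // mulr0 mul0r.
Qed.

Lemma eq_A_alpha_mul e e' y u : e =2 e' ->
  \sum_v A_alpha alpha e u v * y v = \sum_v A_alpha alpha e' u v * y v.
Proof. by move=> ee'; rewrite !A_alpha_mul; apply: eq_bigl => v. Qed.

Definition cut_vector (V : {set 'I_n}) (a b : R) : 'I_n -> R :=
  fun u => if u \in V then b else a.

Lemma sum_cut_vector (V1 V2 : {set 'I_n}) a b c : [disjoint V1 & V2] ->
  \sum_(v | v \notin V1) (c + (1 - alpha) * cut_vector V2 a b v) =
  #|V2|%:R * (c + (1 - alpha) * b)
  + (n%:R - #|V1|%:R - #|V2|%:R) * (c + (1 - alpha) * a).
Proof.
move=> V12; have cardV : (#|V1| + #|V2| + #|~: (V1 :|: V2)| = n)%N.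
  have := cardsC (V1 :|: V2); rewrite card_ord cardsU (disjoint_setI0 V12) cards0.
  by rewrite subn0.
have -> : n%:R - #|V1|%:R - #|V2|%:R = #|~: (V1 :|: V2)|%:R :> R.
  by move/(congr1 (GRing.natmul (1 : R))): cardV; rewrite !natrD => <-; ring.
rewrite (bigID (mem V2)) /=; congr (_ + _).
  rewrite (eq_bigl (mem V2)); last first.
    move=> v; rewrite /=; case: (boolP (v \in V2)); rewrite ?andbF // => vV2.
    by rewrite (disjointFl V12 vV2).
  rewrite mulr_natl -sumr_const; apply: eq_bigr => v vV2.
  by rewrite /cut_vector (vV2 : v \in V2).
rewrite mulr_natl -sumr_const; apply: eq_big => [v|v /andP[_ /negPf vV2]].
  by rewrite !inE negb_or.
by rewrite /cut_vector vV2.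
Qed.

(** The coefficients are those of the 2 x 2 quotient matrix, with [a] the value off V2 and [b] the
    value on V2. *)
Lemma one_way_cut_mul (V1 V2 : {set 'I_n}) a b u : [disjoint V1 & V2] ->
  let p := #|V2|%:R in let k := n%:R - #|V1|%:R - p in
  \sum_v A_alpha alpha (one_way_cut V1 V2) u v * cut_vector V2 a b v =
  if u \in V2 then (1 - alpha) * k * a + (alpha * k + p - 1) * b
  else (n%:R - p - 1 + alpha * p) * a + (1 - alpha) * p * b.
Proof.
move=> V12 p k; rewrite A_alpha_mul.
have offdiag (P : pred 'I_n) (F : 'I_n -> R) : P u ->
    \sum_(v | (u != v) && P v) F v = \sum_(v | P v) F v - F u.
  move=> Pu; rewrite (bigD1 (P := P) u) //= addrAC subrr add0r.
  by apply: eq_bigl => v; rewrite andbC eq_sym.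
case: ifP => uV2.
  rewrite (eq_bigl (fun v => (u != v) && (v \notin V1))); last first.
    by move=> v; rewrite /one_way_cut uV2.
  rewrite (offdiag (fun v => v \notin V1)) ?(disjointFl V12 uV2) //.
  by rewrite sum_cut_vector // /cut_vector uV2 -/p -/k; ring.
(* No head is forbidden here; writing this as avoidance of [set0] lets [sum_cut_vector] apply with
   an empty V1. *)
rewrite (eq_bigl (fun v => (u != v) && (v \notin set0))); last first.
  by move=> v; rewrite /one_way_cut uV2 inE.
rewrite (offdiag (fun v => v \notin set0)) ?inE //.
rewrite sum_cut_vector ?cards0 /cut_vector ?uV2 -/p; last first.
  by rewrite disjoints_subset sub0set.
by ring.
Qed.

Hypothesis alpha01 : 0 <= alpha < 1.

Lemma A_alpha_ge0 e u v : 0 <= A_alpha alpha e u v.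
Proof.
case/andP: alpha01 => a0 a1.
by rewrite A_alphaE addr_ge0 ?mulr_ge0 ?mulrn_wge0 // subr_ge0 ltW.
Qed.

Lemma A_alpha_gt0 e u v : e u v -> 0 < A_alpha alpha e u v.
Proof.
case/andP: alpha01 => a0 a1 uv.
by rewrite A_alphaE uv mulr1 ltr_wpDl ?mulr_ge0 ?mulrn_wge0 // subr_gt0.
Qed.

(** Each arc contributes a strictly positive term, so row u is unchanged only if no arc out of u was
    added. *)
Lemma A_alpha_mul_sub e e' y u : (forall v, 0 < y v) -> subrel e e' ->
  \sum_v A_alpha alpha e u v * y v <= \sum_v A_alpha alpha e' u v * y v
  ?= iff [forall v, e' u v ==> e u v].
Proof.
move=> y_gt0 ee'; case/andP: alpha01 => a0 a1.
have term_gt0 v : 0 < alpha * y u + (1 - alpha) * y v.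
  by rewrite ltr_wpDl ?mulr_ge0 ?mulr_gt0 ?subr_gt0 // ltW.
rewrite !A_alpha_mul [X in X <= _ ?= iff _]big_mkcond [X in _ <= X ?= iff _]big_mkcond /=.
have -> : [forall v, e' u v ==> e u v] = [forall (v | true), e' u v ==> e u v].
  by apply: eq_forallb.
apply: leif_sum => v _; case: (boolP (e u v)) => [/ee' ->|_] /=.
  by split; rewrite ?eqxx ?implybT.
case: (e' u v) => /=; last by split; rewrite ?eqxx.
by split; [exact: ltW | rewrite lt_eqF].
Qed.

End AlphaMatrix.

(** * The bound as a root of a quadratic *)

Section Bound.
Variables (R : realType) (alpha : R).

Definition alpha_bound (n k : R) : R :=
  (n - 2 + alpha + alpha * k
   + Num.sqrt (n ^+ 2 + (2 * alpha - 4 - 2 * alpha * k) * n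
               + alpha ^+ 2 + alpha ^+ 2 * k ^+ 2 - 4 * alpha
               + 2 * alpha ^+ 2 * k - 4 * alpha * k + 4 * k + 4)) / 2.

Hypothesis alpha01 : 0 <= alpha < 1.

Lemma alpha_boundP (n k : R) : 0 < k -> k < n - 1 ->
  let L := alpha_bound n k in
  [/\ (L - (n - 2 + alpha)) * (L - alpha * k) = (1 - alpha) ^+ 2 * k,
      n - 2 + alpha < L & L < n - 1].
Proof.
case/andP: alpha01 => a0 a1 k0 kn; rewrite /alpha_bound.
set D := (X in Num.sqrt X); set s := Num.sqrt D; cbv zeta; set L := _ / 2.
have sE : s = 2 * L - (n - 2 + alpha + alpha * k) by rewrite /L; field.
(* The discriminant of a 2 x 2 matrix: squared difference of the diagonal entries plus four times
   the product of the others. *)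
have DE : D = (n - 2 + alpha - alpha * k) ^+ 2 + 4 * ((1 - alpha) ^+ 2 * k).
  by rewrite /D; ring.
have gap : 0 < (1 - alpha) ^+ 2 * k by rewrite mulr_gt0 ?exprn_gt0 ?subr_gt0.
have s2 : s ^+ 2 = D.
  by rewrite sqr_sqrtr // DE addr_ge0 ?sqr_ge0 // mulr_ge0 ?ltW.
have ak : alpha * k <= k by rewrite ler_piMl ?ltW.
have L1 : n - 2 + alpha < L.
  suff : n - 2 + alpha - alpha * k < s by rewrite sE; lra.
  apply: le_lt_trans (ler_norm _) _; rewrite -sqrtr_sqr ltr_sqrt; first lra.
  by rewrite DE ltr_wpDl ?sqr_ge0 // mulr_gt0.
have root : (L - (n - 2 + alpha)) * (L - alpha * k) = (1 - alpha) ^+ 2 * k.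
  by apply: (mulfI (x := 4)); rewrite ?pnatr_eq0 //; move: s2; rewrite sE DE; lra.
split=> //; rewrite ltNge; apply/negP => nL.
(* If n - 1 <= L, the factors are at least 1 - alpha and more than k - alpha k, so their product
   exceeds its known value. *)
suff : (1 - alpha) * (k - alpha * k) < (L - (n - 2 + alpha)) * (L - alpha * k).
  by rewrite root; apply/negP; rewrite -leNgt; lra.
apply: (@lt_le_trans _ _ ((1 - alpha) * (L - alpha * k))).
  by rewrite ltr_pM2l; lra.
by apply: ler_wpM2r; lra.
Qed.

End Bound.

(** * The test vector, its defect, and the case of equality for a fixed cut *)

Section OneWayCutBound.
Variables (R : realType) (alpha : R) (n k : nat) (G : rel 'I_n).
Variables V1 V2 : {set 'I_n}.
Hypotheses (alpha01 : 0 <= alpha < 1) (k_gt0 : (0 < k)%N).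
Hypotheses (V12 : [disjoint V1 & V2]).
Hypotheses (V1_gt0 : (0 < #|V1|)%N) (V2_gt0 : (0 < #|V2|)%N).
Hypothesis cardV : (k + #|V1| + #|V2| = n)%N.

Let L : R := alpha_bound alpha n%:R k%:R.
Let m : R := #|V1|%:R.
Let p : R := #|V2|%:R.
(** The two values solve the V2 row of the quotient system for L exactly. *)
Let y := cut_vector V2 (L - (alpha * k%:R + p - 1)) ((1 - alpha) * k%:R).

(* If [f_p] denotes the characteristic polynomial of the 2 x 2 quotient matrix *)
(* of [K(n,k,n-k-p)], this is [f_p L], where L is the largest root of [f_1].   *)
Let gap : R := (p - 1) * (alpha * (n%:R - 1 - L) + (1 - alpha) * (m - 1)).

Let card_real : n%:R = k%:R + m + p :> R.
Proof. by rewrite /m /p -!natrD cardV. Qed.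

Let k_ge1 : 1 <= k%:R :> R. Proof. by rewrite ler1n. Qed.
Let m_ge1 : 1 <= m. Proof. by rewrite ler1n. Qed.
Let p_ge1 : 1 <= p. Proof. by rewrite ler1n. Qed.

Let L_spec :
  [/\ (L - (n%:R - 2 + alpha)) * (L - alpha * k%:R) = (1 - alpha) ^+ 2 * k%:R,
      n%:R - 2 + alpha < L & L < n%:R - 1].
Proof. by apply: alpha_boundP => //; move: card_real k_ge1 m_ge1 p_ge1; lra. Qed.

Let L_gt0 : 0 < L.
Proof. by case: L_spec => _ + _; case/andP: alpha01; move: card_real k_ge1 m_ge1 p_ge1; lra. Qed.

Let y_gt0 u : 0 < y u.
Proof.
case: L_spec => _ L1 _; case/andP: alpha01 => a0 a1.
rewrite /y /cut_vector; case: ifP => _; first by rewrite mulr_gt0 ?subr_gt0 ?ltr0n.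
have : 0 < (1 - alpha) * k%:R by rewrite mulr_gt0 ?subr_gt0 ?ltr0n.
by move: card_real k_ge1 m_ge1 p_ge1; lra.
Qed.

Let gap_ge0 : 0 <= gap.
Proof.
case: L_spec => _ _ L2; case/andP: alpha01 => a0 a1.
apply: mulr_ge0; first by move: p_ge1; lra.
by apply: addr_ge0; apply: mulr_ge0; move: m_ge1; lra.
Qed.

Let gap_eq0 : gap = 0 <-> #|V2| = 1%N \/ alpha = 0 /\ #|V1| = 1%N.
Proof.
have eq1 (x : nat) : (x%:R - 1 == 0 :> R) = (x == 1%N).
  by rewrite subr_eq0 -(eqr_nat R).
case: L_spec => _ _ L2; case/andP: alpha01 => a0 a1.
split=> [/eqP|[p1|[a00 m1]]]; last 2 first.
- by rewrite /gap /p p1 subrr mul0r.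
- by rewrite /gap /m m1 a00 subrr mul0r mulr0 addr0 mulr0.
rewrite mulf_eq0 /p eq1 => /orP[/eqP|]; first by left.
have h1 : 0 <= alpha * (n%:R - 1 - L) by apply: mulr_ge0; lra.
have h2 : 0 <= (1 - alpha) * (m - 1) by apply: mulr_ge0; move: m_ge1; lra.
have L_neq : n%:R - 1 - L != 0 by rewrite lt0r_neq0 // subr_gt0.
have a_neq : 1 - alpha != 0 by rewrite lt0r_neq0 // subr_gt0.
rewrite (paddr_eq0 h1 h2) !mulf_eq0 (negPf L_neq) (negPf a_neq) orbF /= /m eq1.
by case/andP => /eqP a00 /eqP m1; right.
Qed.

Let cut_mul u :
  L * y u - \sum_v A_alpha alpha (one_way_cut V1 V2) u v * y v =
  if u \in V2 then 0 else gap.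
Proof.
case: L_spec => root _ _.
rewrite /y one_way_cut_mul // -/m -/p /cut_vector.
have -> : n%:R - m - p = k%:R by rewrite card_real; ring.
case: ifP => _; first by ring.
apply/eqP; rewrite -subr_eq0 /gap; apply/eqP.
(* This is f_1(L) = 0: the difference f_p - f_1, evaluated at L, is [gap] identically. *)
transitivity ((L - (n%:R - 2 + alpha)) * (L - alpha * k%:R)
              - (1 - alpha) ^+ 2 * k%:R); last by rewrite root subrr.
by rewrite card_real; ring.
Qed.

Let cut_mul_le u :
  \sum_v A_alpha alpha (one_way_cut V1 V2) u v * y v <= L * y u.
Proof. by rewrite -subr_ge0 cut_mul; case: ifP. Qed.

Lemma sub_one_way_cut_lambda_le : subrel G (one_way_cut V1 V2) ->
  lambda_alpha alpha G <= alpha_bound alpha n%:R k%:R.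
Proof.
move=> subG; apply: (@spectral_radius_le _ _ _ _ y) => [i j|//|i|].
- exact: A_alpha_ge0.
- by apply: le_trans (cut_mul_le i); rewrite A_alpha_mul_sub.
- exact: ltW.
Qed.

Lemma sub_one_way_cut_lambda_eq :
  strongly_connected G -> subrel G (one_way_cut V1 V2) ->
  lambda_alpha alpha G = alpha_bound alpha n%:R k%:R ->
  G =2 one_way_cut V1 V2 /\ (#|V2| = 1%N \/ alpha = 0 /\ #|V1| = 1%N).
Proof.
move=> G_sc subG lambdaL.
have sub_mul u := A_alpha_mul_sub alpha01 u y_gt0 subG.
have Gy : forall u, \sum_v A_alpha alpha G u v * y v = L * y u.
  apply: (@spectral_radius_eq _ _ _ _ _ _ _ _ G) => // [u v|u|u v].
  - exact: A_alpha_ge0.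
  - by apply: le_trans (cut_mul_le u); rewrite sub_mul.
  - exact: A_alpha_gt0.
have cuty u : \sum_v A_alpha alpha (one_way_cut V1 V2) u v * y v = L * y u.
  by apply/le_anti; rewrite cut_mul_le -Gy sub_mul.
split=> [u v|].
  have := (sub_mul u).2; rewrite Gy cuty eqxx.
  move=> /esym/forallP/(_ v)/implyP cutG.
  by apply/idP/idP; [exact: subG | exact: cutG].
(* A vertex of V1 lies off V2, so its row exhibits the defect [gap]. *)
apply/gap_eq0; case/card_gt0P: V1_gt0 => u uV1.
by have := cut_mul u; rewrite cuty subrr (disjointFr V12 uV1).
Qed.

Lemma one_way_cut_lambda : G =2 one_way_cut V1 V2 ->
  #|V2| = 1%N \/ alpha = 0 /\ #|V1| = 1%N ->
  lambda_alpha alpha G = alpha_bound alpha n%:R k%:R.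
Proof.
move=> GE /gap_eq0 gap0; apply/le_anti.
rewrite sub_one_way_cut_lambda_le; last by move=> u v; rewrite GE.
case/card_gt0P: V1_gt0 => u _.
apply: (@right_eigenvector_spectral_radius _ _ _ y _ u) => [||v].
- exact: ltW.
- exact: lt0r_neq0.
- apply/eqP; rewrite (eq_A_alpha_mul _ _ _ GE) eq_sym -subr_eq0 cut_mul gap0.
  by case: ifP.
Qed.

End OneWayCutBound.

(** * The bound for all alpha in [0, 1), then its specialisation to the two ranges *)

Lemma lambda_alpha_bound (R : realType) (n k : nat) (G : rel 'I_n) (alpha : R) :
  (1 <= k)%N -> (k + 2 <= n)%N -> irreflexive G -> strongly_connected G ->
  has_vertex_connectivity G k -> 0 <= alpha < 1 ->
  lambda_alpha alpha G <= alpha_bound alpha n%:R k%:R /\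
  (lambda_alpha alpha G = alpha_bound alpha n%:R k%:R <->
   digraph_iso G (K_digraph n k (n - k - 1)) \/
   alpha = 0 /\ digraph_iso G (K_digraph n k 1)).
Proof.
move=> k_ge1 k_le G_irr G_sc [[S Sk S_sep] _] alpha01.
have [V1 [V2 [V12 V1_gt0 V2_gt0 cardV subG]]] : exists V1 V2 : {set 'I_n},
    [/\ [disjoint V1 & V2], (0 < #|V1|)%N, (0 < #|V2|)%N,
      (k + #|V1| + #|V2| = n)%N & subrel G (one_way_cut V1 V2)].
  by have := separator_one_way_cut G_irr S_sep; rewrite Sk card_ord.
split; first exact: sub_one_way_cut_lambda_le subG.
rewrite !digraph_iso_K_digraph; try lia.
split=> [/(sub_one_way_cut_lambda_eq alpha01 k_ge1 V12 V1_gt0 V2_gt0 cardV G_sc subG)|].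
  case=> GE [V2_1|[a0 V1_1]]; [left | right; split=> //];
    by exists V1, V2; split=> //; lia.
(* The cut W1, W2 comes from the isomorphism and may differ from the one given by the separator. *)
case=> [|[a0]] [W1 [W2 [W12 W1c W2c GE]]].
  by apply: (one_way_cut_lambda _ _ W12 _ _ _ GE); first [lia | left; lia | done].
by apply: (one_way_cut_lambda _ _ W12 _ _ _ GE); first [lia | right; split=> //; lia | done].
Qed.

Theorem theorem5p2 (R : realType) (n k : nat) (G : rel 'I_n)
    (n_gt0 : (0 < n)%N) (k_ge1 : (1 <= k)%N) (k_le : (k + 2 <= n)%N)
    (G_simple : irreflexive G) (G_sc : strongly_connected G)
    (G_conn : has_vertex_connectivity G k) :
  (let bound : R :=
     (n%:R - 2 + Num.sqrt (n%:R ^+ 2 - 4 * n%:R + 4 * k%:R + 4)) / 2 in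
   lambda_alpha 0 G <= bound /\
   (lambda_alpha 0 G = bound <->
      digraph_iso G (K_digraph n k (n - k - 1)) \/
      digraph_iso G (K_digraph n k 1)))
  /\
  (forall alpha : R, 0 < alpha -> alpha < 1 ->
   let bound : R :=
     (n%:R - 2 + alpha + alpha * k%:R
      + Num.sqrt (n%:R ^+ 2 + (2 * alpha - 4 - 2 * alpha * k%:R) * n%:R
                  + alpha ^+ 2 + alpha ^+ 2 * k%:R ^+ 2 - 4 * alpha
                  + 2 * alpha ^+ 2 * k%:R - 4 * alpha * k%:R
                  + 4 * k%:R + 4)) / 2 in
   lambda_alpha alpha G <= bound /\
   (lambda_alpha alpha G = bound <->
      digraph_iso G (K_digraph n k (n - k - 1)))).
Proof.
have general := @lambda_alpha_bound R _ _ _ _ k_ge1 k_le G_simple G_sc G_conn.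
split=> [bound|alpha a0 a1 bound].
  have boundE : bound = alpha_bound 0 n%:R k%:R.
    by rewrite /bound /alpha_bound; congr ((_ + Num.sqrt _) / 2); ring.
  have := general 0; rewrite lexx ltr01 -boundE => /(_ isT)[lambda_le lambda_eq].
  split=> //; rewrite lambda_eq; split=> [[|[]]|[]]; tauto.
have := general alpha; rewrite ltW // a1 => /(_ isT)[lambda_le lambda_eq].
(* The second extremal digraph requires alpha = 0, which [a0] excludes. *)
split=> //; rewrite lambda_eq; split=> [[//|[a00]]|]; last by left.
by rewrite a00 ltxx in a0.
Qed.
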